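(* Let $\varkappa\in(1,\varkappa_{\max}]$ and let $\mu$ satisfy $$\varkappa^{2/3}\le\mu\le\frac{(\varkappa^2+1)^2}{\varkappa^4+\varkappa^2+1}.$$ Let $$A=\begin{pmatrix}0&-\frac1\varkappa\\ \varkappa&-1\end{pmatrix},\qquad B=\begin{pmatrix}0&-\varkappa\\ \frac1\varkappa&-1\end{pmatrix},\qquad \tilde A=\varkappa^{-2/3}A,\qquad \tilde B=\varkappa^{-2/3}B,$$ and let $S$ be the polygon with vertices $v_1,\ldots,v_{12}$ given by $$v_1=\mu v,\quad v_2=w,\quad v_3=-\tilde Av_1,\quad v_4=-\tilde Av_2,\quad v_5=-\tilde Av_3,\quad v_6=-\tilde Bv_4,\qquad v_{i+6}=-v_i\ (i=1,\ldots,6),$$ where $v=\begin{pmatrix}1\\ \frac{\varkappa}{1+\varkappa^2}\end{pmatrix}$ and $w=\begin{pmatrix}1\\0\end{pmatrix}$. Then $$\tilde Av_i\in S,\qquad \tilde Bv_i\in S\qquad\text{for } i=1,2,\ldots,12,$$ and, consequently, there is a norm $\|\cdot\|$ on $\mathbb{R}^2$ with unit ball $S$ such that $$\|\tilde Ax\|\le\|x\|,\qquad \|\tilde Bx\|\le\|x\|\qquad\text{for all } x\in\mathbb{R}^2.$$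
   Context: The number $\varkappa_{\max}$ ($\approx 1.447892$) is the unique solution $\varkappa>1$ of the equation $\varkappa^{2/3}=\dfrac{(\varkappa^2+1)^2}{\varkappa^4+\varkappa^2+1}$. The polygon $S$ is understood as a closed region (filled polygon): $S=\bigcup_{i=1}^{12}\triangle v_iv_{i+1}0$ with $v_{13}:=v_1$, where for $x,y\in\mathbb{R}^2$, $\triangle xy0=\{sx+ty:\ s,t\ge0,\ s+t\le1\}$. (The indexing of the $v_i$ is the cyclic order in which the vertices occur when going clockwise around the origin.) *)

(* Defs.v *)
From mathcomp Require Import all_boot all_order all_algebra.
From mathcomp Require Import ring lra.
From mathcomp Require Import all_classical all_reals all_analysis.

Set Implicit Arguments.
Unset Strict Implicit.
Unset Printing Implicit Defensive.

Import Order.TTheory GRing.Theory Num.Theory.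
Import numFieldNormedType.Exports.

Local Open Scope classical_set_scope.
Local Open Scope ring_scope.

Definition mu_max {R : realType} (k : R) : R :=
  (k ^+ 2 + 1) ^+ 2 / (k ^+ 4 + k ^+ 2 + 1).

(* The choice is well defined: see [kappa_max_exists_unique] and
   [kappa_maxP] below. *)
Definition kappa_max (R : realType) : R :=
  [get k : R | 1 < k /\ k `^ (2 / 3) = mu_max k].

Definition mx22 {R : realType} (a b c d : R) : 'M[R]_2 :=
  \matrix_(i, j) if i == 0 then (if j == 0 then a else b)
                 else (if j == 0 then c else d).

Definition cv2 {R : realType} (a b : R) : 'cV[R]_2 :=
  \col_i if i == 0 then a else b.

Definition Amx {R : realType} (k : R) : 'M[R]_2 := mx22 0 (- k^-1) k (- 1).
Definition Bmx {R : realType} (k : R) : 'M[R]_2 := mx22 0 (- k) k^-1 (- 1).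

Definition Atilde {R : realType} (k : R) : 'M[R]_2 :=
  k `^ (- (2 / 3)) *: Amx k.
Definition Btilde {R : realType} (k : R) : 'M[R]_2 :=
  k `^ (- (2 / 3)) *: Bmx k.

Definition half_vertices {R : realType} (k mu : R) : seq 'cV[R]_2 :=
  let v1 := mu *: cv2 1 (k / (1 + k ^+ 2)) in
  let v2 := cv2 1 0 in
  let v3 := - (Atilde k *m v1) in
  let v4 := - (Atilde k *m v2) in
  let v5 := - (Atilde k *m v3) in
  let v6 := - (Btilde k *m v4) in
  [:: v1; v2; v3; v4; v5; v6].

(* Indices are shifted by one: [vertex k mu i] is v_(i+1), for i = 0, ..., 11. *)
Definition vertex {R : realType} (k mu : R) (i : 'I_12) : 'cV[R]_2 :=
  (half_vertices k mu ++ [seq - x | x <- half_vertices k mu])`_i.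

Definition triangle0 {R : realType} (x y : 'cV[R]_2) : set 'cV[R]_2 :=
  [set z | exists s t : R,
     [/\ 0 <= s, 0 <= t, s + t <= 1 & z = s *: x + t *: y]].

(* [ordS] is the cyclic successor, so the last triangle joins v_12 to v_1. *)
Definition polygonS {R : realType} (k mu : R) : set 'cV[R]_2 :=
  \bigcup_(i in [set: 'I_12]) triangle0 (vertex k mu i) (vertex k mu (ordS i)).

(* The axioms are those of the factory [Lmodule_isNormed]; a predicate is used
   because 'cV[R]_2 already carries a canonical norm (the sup norm).
   Nonnegativity follows from these axioms. *)
Record is_norm {R : realType} (N : 'cV[R]_2 -> R) : Prop := IsNorm {
  is_norm_triangle : forall x y, N (x + y) <= N x + N y ;
  is_normZ : forall (a : R) x, N (a *: x) = `|a| * N x ;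
  is_norm_eq0 : forall x, N x = 0 -> x = 0
}.

Definition unit_ball {R : realType} (N : 'cV[R]_2 -> R) : set 'cV[R]_2 :=
  [set x | N x <= 1].

Lemma powR23_cube {R : realType} (k : R) : 0 < k ->
  (k `^ (2 / 3)) ^+ 3 = k ^+ 2.
Proof.
move=> k0; rewrite -powR_mulrn ?powR_ge0// -powRrM.
by rewrite (_ : 2 / 3 * 3%:R = 2%:R :> R) ?powR_mulrn ?ltW//; field.
Qed.

(* With x = k^(2/3), so that k^2 = x^3, the equation for k becomes a polynomial
   equation in x. *)
Lemma kappa_eqE {R : realType} (k : R) : 0 < k ->
  let x := k `^ (2 / 3) in
  (x = mu_max k) <-> (x ^+ 7 - x ^+ 6 + x ^+ 4 - 2 * x ^+ 3 + x - 1 = 0).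
Proof.
move=> k0 x; have xk : k ^+ 2 = x ^+ 3 by rewrite /x powR23_cube.
have x0 : 0 < x by rewrite powR_gt0.
have d0 : x ^+ 6 + x ^+ 3 + 1 != 0.
  by rewrite gt_eqF// !addr_gt0// exprn_gt0.
rewrite /mu_max (_ : k ^+ 4 = x ^+ 6); last first.
  by rewrite -[4%N]/(2 * 2)%N exprM xk -exprM.
rewrite xk; split=> [h|h].
  have : x * (x ^+ 6 + x ^+ 3 + 1) = (x ^+ 3 + 1) ^+ 2.
    by rewrite [X in X * _]h mulfVK.
  move/eqP; rewrite -subr_eq0 => /eqP h'; rewrite -[RHS]h'; ring.
apply: (mulIf d0); rewrite mulfVK//; apply/eqP; rewrite -subr_eq0.
by apply/eqP; rewrite -[RHS]h; ring.
Qed.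

Lemma kappa_poly_lt {R : realType} (x y : R) : 1 < x -> x < y ->
  x ^+ 7 - x ^+ 6 + x ^+ 4 - 2 * x ^+ 3 + x - 1 <
  y ^+ 7 - y ^+ 6 + y ^+ 4 - 2 * y ^+ 3 + y - 1.
Proof.
have qE (z : R) : z ^+ 7 - z ^+ 6 + z ^+ 4 - 2 * z ^+ 3 + z - 1 =
    (z - 1) ^+ 7 + 6 * (z - 1) ^+ 6 + 15 * (z - 1) ^+ 5 + 21 * (z - 1) ^+ 4
      + 17 * (z - 1) ^+ 3 + 6 * (z - 1) ^+ 2 - 1 by ring.
move=> x1 xy; rewrite !qE; have u0 : 0 <= x - 1 by lra.
have uw : x - 1 < y - 1 by lra.
have lt n : (x - 1) ^+ n.+1 < (y - 1) ^+ n.+1 by rewrite ltrXn2r.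
have := (lt 6, lt 5, lt 4, lt 3, lt 2, lt 1)%N.
by move=> [[[[[]]]]]; lra.
Qed.

Lemma kappa_max_exists_unique (R : realType) :
  exists! k : R, 1 < k /\ k `^ (2 / 3) = mu_max k.
Proof.
have r0 : (0 : R) < 2 / 3 by lra.
have x1 (k : R) : 1 < k -> 1 < k `^ (2 / 3).
  move=> k1; have := @gt0_ltr_powR R _ r0 1 k; rewrite powR1.
  by apply; rewrite ?nnegrE//; lra.
pose p : {poly R} := 'X^7 - 'X^6 + 'X^4 - 2 *: 'X^3 + 'X - 1.
have pE x : p.[x] = x ^+ 7 - x ^+ 6 + x ^+ 4 - 2 * x ^+ 3 + x - 1.
  by rewrite /p !hornerE.
have p12 : p.[1] <= 0 <= p.[2] by rewrite !pE; apply/andP; split; lra.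
have le12 : (1 : R) <= 2 by lra.
have [x /andP[x1' x2] /rootP] := poly_ivt le12 p12.
rewrite pE => px; have {}x1' : 1 < x.
  rewrite lt_neqAle x1' andbT; apply/eqP => e; move: px; rewrite -e; lra.
have x0 : 0 < x by lra.
pose k := Num.sqrt (x ^+ 3).
have kE : k ^+ 2 = x ^+ 3 by rewrite sqr_sqrtr// exprn_ge0// ltW.
have k1 : 1 < k by rewrite -sqrtr1 ltr_sqrt ?exprn_gt0// exprn_egt1.
have k0 : 0 < k by lra.
have kx : k `^ (2 / 3) = x.
  apply/eqP; rewrite -(@eqrXn2 _ 3)// ?powR_ge0 ?(ltW x0)//.
  by rewrite powR23_cube// kE.
exists k; split; first by split=> //; apply/kappa_eqE => //; rewrite kx.
move=> l [l1 /kappa_eqE]; have l0 : 0 < l by lra.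
move=> /(_ l0) pl; have lx : l `^ (2 / 3) = x.
  have [| |//] := ltgtP (l `^ (2 / 3)) x.
    by move=> /(kappa_poly_lt (x1 _ l1)); lra.
  by move=> /(kappa_poly_lt x1'); lra.
apply: (powR_injective r0); rewrite ?nnegrE ?ltW//=.
by rewrite kx lx.
Qed.

Lemma kappa_maxP (R : realType) :
  1 < kappa_max R /\ kappa_max R `^ (2 / 3) = mu_max (kappa_max R).
Proof.
have [k [Pk _]] := kappa_max_exists_unique R.
exact: (@getPex R (fun k => 1 < k /\ k `^ (2 / 3) = mu_max k) (ex_intro _ k Pk)).
Qed.

(* Main.v *)
Require Import Defs.
From mathcomp Require Import all_boot all_order all_algebra.
From mathcomp Require Import ring lra.
From mathcomp Require Import all_classical all_reals all_analysis.

Set Implicit Arguments.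
Unset Strict Implicit.
Unset Printing Implicit Defensive.

Import Order.TTheory GRing.Theory Num.Theory.
Import numFieldNormedType.Exports.

Local Open Scope classical_set_scope.
Local Open Scope ring_scope.

(** Write [x] for [k `^ (2 / 3)], so that [x ^+ 3 = k ^+ 2], and [v_1, ..., v_12]
    for the vertices.

    The polygon is the unit ball of a norm as soon as its vertices are listed in
    clockwise order, once around the origin, and each of them is a convex corner.
    The norm is not obtained as a maximum of linear forms, which would require
    comparing every vertex with every edge line, but as a sum: in the
    plane the polar of a centrally symmetric convex polygon is a sum of segments,
    so the norm is a combination [\sum_i c_i * `|cross v_i z|] over half of the
    vertices, where the coefficient [c_i >= 0] measures how much the boundary
    turns at [v_i].  Such a sum is visibly a seminorm ([tour_norm]), and on the cone
    over an edge it is the linear form equal to 1 on that edge, because there the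
    sum telescopes ([tour_norm_cone]).  The cones cover the plane
    ([tour_cones_cover]), so the unit ball is the polygon, and a linear map is a
    contraction as soon as it sends the vertices into the polygon
    ([tour_contraction]).

    For the vertices of the theorem, convexity at the six corners
    ([vertex_polygon]) comes down to [1 + k ^+ 2 <= mu * (1 + x ^+ 2)],
    [x * (1 + k ^+ 2) <= mu * (1 + x ^+ 4)] and two upper bounds on [mu], which
    hold because [1 <= x <= mu] and
    [mu * (1 + k ^+ 2 + k ^+ 4) <= (1 + k ^+ 2) ^+ 2].

    Eight of the twelve images of [v_1, ..., v_6] under the two matrices are
    a vertex, or a vertex divided by [k ^+ 2]: the vertices are built as images of
    one another, the cubes of [A] and [B] are the identity, and [v] and [w] are
    eigenvectors of [B * A ^+ 2] and [B ^+ 2 * A] for the eigenvalue [k ^+ 2], which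
    is the cube of the scaling factor [x].  The other images
    are [Atilde v_4], [Atilde v_6], [Btilde v_1] and [Btilde v_3], which lie in the
    cones over the edges [v_11 v_12], [v_2 v_3], [v_8 v_9] and [v_11 v_12]
    ([Atilde_vertex], [Btilde_vertex]).  They are in the polygon when [1 <= mu],
    [x <= mu], [mu * (1 + k ^+ 2 + k ^+ 4) <= x * (1 + k ^+ 2) ^+ 2] and
    [mu * (1 + k ^+ 2 + k ^+ 4) <= (1 + k ^+ 2) ^+ 2] respectively; the second and
    the fourth are exactly the two bounds assumed on [mu]. *)

(** * The cross product of the plane *)

(** The sign is chosen so that [cross x y] is positive when [y] lies clockwise
    from [x], the direction in which the vertices are listed. *)
Definition cross {R : realType} (x y : 'cV[R]_2) : R :=
  x 1 0 * y 0 0 - x 0 0 * y 1 0.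

Lemma crossC (R : realType) (x y : 'cV[R]_2) : cross y x = - cross x y.
Proof. by rewrite /cross; ring. Qed.

Lemma crossxx (R : realType) (x : 'cV[R]_2) : cross x x = 0.
Proof. by rewrite /cross; ring. Qed.

Lemma crossDr (R : realType) (x y z : 'cV[R]_2) :
  cross x (y + z) = cross x y + cross x z.
Proof. by rewrite /cross !mxE; ring. Qed.

Lemma crossZr (R : realType) (a : R) (x y : 'cV[R]_2) :
  cross x (a *: y) = a * cross x y.
Proof. by rewrite /cross !mxE; ring. Qed.

Lemma crossNr (R : realType) (x y : 'cV[R]_2) : cross x (- y) = - cross x y.
Proof. by rewrite /cross !mxE; ring. Qed.

Lemma crossBl (R : realType) (x y z : 'cV[R]_2) :
  cross (x - y) z = cross x z - cross y z.
Proof. by rewrite /cross !mxE; ring. Qed.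

Lemma crossZl (R : realType) (a : R) (x y : 'cV[R]_2) :
  cross (a *: x) y = a * cross x y.
Proof. by rewrite /cross !mxE; ring. Qed.

Lemma crossNl (R : realType) (x y : 'cV[R]_2) : cross (- x) y = - cross x y.
Proof. by rewrite /cross !mxE; ring. Qed.

Lemma eq_cV2 (R : realType) (x y : 'cV[R]_2) :
  x 0 0 = y 0 0 -> x 1 0 = y 1 0 -> x = y.
Proof.
move=> e0 e1; apply/colP => i.
have [->|->] // : i = 0 \/ i = 1.
by case: i => [[|[|//]] ?]; [left|right]; exact: val_inj.
Qed.

(** Cramer's rule: the coordinates of [z] in the basis [x, y]. *)
Lemma cross_cramer (R : realType) (x y z : 'cV[R]_2) :
  cross x y *: z = - cross y z *: x + cross x z *: y.
Proof. by apply: eq_cV2; rewrite /cross !mxE; ring. Qed.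

(** * Centrally symmetric convex polygons and their norms *)

(** A centrally symmetric polygon with [2 * n] vertices is encoded by an
    infinite clockwise tour [w] of its vertices, in which half a turn is a shift
    by [n] and changes the sign.  The fields [sym_ahead] and [sym_step] say that
    the tour goes once around the origin; [sym_turn] is convexity at the vertex
    [w i.+1] alone. *)
Record symmetric_polygon {R : realType} (n : nat) (w : nat -> 'cV[R]_2) : Prop :=
  SymmetricPolygon {
    sym_anti : forall i, w (i + n)%N = - w i ;
    sym_ahead : forall i j, (i <= j <= i + n)%N -> 0 <= cross (w i) (w j) ;
    sym_step : forall i, 0 < cross (w i) (w i.+1) ;
    sym_turn : forall i, cross (w i) (w i.+2) <=
                 cross (w i) (w i.+1) + cross (w i.+1) (w i.+2)
  }.

Definition tour_region {R : realType} (w : nat -> 'cV[R]_2) : set 'cV[R]_2 :=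
  \bigcup_(i in [set: nat]) triangle0 (w i) (w i.+1).

(** [cross (edge_dual w i)] is the linear form equal to 1 along the edge from
    [w i] to [w i.+1]; up to a quarter turn, these are the vertices of the polar
    polygon. *)
Definition edge_dual {R : realType} (w : nat -> 'cV[R]_2) (i : nat) : 'cV[R]_2 :=
  (cross (w i) (w i.+1))^-1 *: (w i - w i.+1).

(** Half the total variation, over half a turn, of the values at [z] of the
    edge forms.  Equivalently, the support function of the polar polygon written
    as a sum of segments. *)
Definition tour_norm {R : realType} (n : nat) (w : nat -> 'cV[R]_2)
    (z : 'cV[R]_2) : R :=
  2^-1 * \sum_(0 <= i < n) `|cross (edge_dual w i.+1 - edge_dual w i) z|.

Lemma tour_normD (R : realType) n (w : nat -> 'cV[R]_2) x y :
  tour_norm n w (x + y) <= tour_norm n w x + tour_norm n w y.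
Proof.
rewrite /tour_norm -mulrDr ler_pM2l ?invr_gt0 ?ltr0n// -big_split/=.
by apply: ler_sum => i _; rewrite crossDr ler_normD.
Qed.

Lemma tour_normZ (R : realType) n (w : nat -> 'cV[R]_2) a x :
  tour_norm n w (a *: x) = `|a| * tour_norm n w x.
Proof.
rewrite /tour_norm mulrCA; congr (_ * _); rewrite mulr_sumr.
by apply: eq_bigr => i _; rewrite crossZr normrM.
Qed.

Lemma tour_normN (R : realType) n (w : nat -> 'cV[R]_2) x :
  tour_norm n w (- x) = tour_norm n w x.
Proof. by rewrite -scaleN1r tour_normZ normrN1 mul1r. Qed.

Lemma edge_dual_anti (R : realType) n (w : nat -> 'cV[R]_2) :
  symmetric_polygon n w ->
  forall i, edge_dual w (i + n) = - edge_dual w i.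
Proof.
move=> Pw i; rewrite /edge_dual -addSn !(sym_anti Pw) crossNl crossNr opprK.
by rewrite -scalerN opprB opprK addrC.
Qed.

(** The variation over half a turn is the same from any starting point, because
    the forms change sign after half a turn. *)
Lemma tour_norm_window (R : realType) n (w : nat -> 'cV[R]_2) j z :
  symmetric_polygon n w ->
  tour_norm n w z =
  2^-1 * \sum_(j <= i < j + n) `|cross (edge_dual w i.+1 - edge_dual w i) z|.
Proof.
move=> Pw; rewrite /tour_norm; congr (_ * _).
elim: j => [|j ->]; first by rewrite add0n.
set F := fun i => `|cross (edge_dual w i.+1 - edge_dual w i) z|.
have Fn : F (j + n)%N = F j.
  by rewrite /F -addSn !edge_dual_anti// -opprD crossNl normrN.
have jn : (j <= j + n)%N by rewrite leq_addr.
apply: (addrI (F j)); rewrite addSn -[RHS]big_ltn ?ltnS//.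
by rewrite big_nat_recr//= Fn addrC.
Qed.

(** Convexity at [w i.+1] says that the polar polygon moves forward: two
    consecutive edge forms agree at their common vertex, so they differ by a
    multiple of [cross (w i.+1)], and the sign of the factor is that of the turn. *)
Lemma edge_dual_turn (R : realType) n (w : nat -> 'cV[R]_2) i :
  symmetric_polygon n w ->
  exists2 c, 0 <= c & edge_dual w i.+1 - edge_dual w i = c *: w i.+1.
Proof.
move=> Pw; have D0 := sym_step Pw i; have D1 := sym_step Pw i.+1.
exists ((cross (w i) (w i.+1) + cross (w i.+1) (w i.+2) - cross (w i) (w i.+2))
   / (cross (w i) (w i.+1) * cross (w i.+1) (w i.+2))).
  by rewrite divr_ge0 ?mulr_ge0 ?(ltW D0) ?(ltW D1)// subr_ge0 (sym_turn Pw).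
move: (lt0r_neq0 D0) (lt0r_neq0 D1); rewrite /edge_dual /cross => n0 n1.
by apply: eq_cV2; rewrite !mxE; field; rewrite n0 n1.
Qed.

(** On the cone spanned by an edge, the edge forms met during the following half
    turn decrease from [s + t] to [- (s + t)], so the variation telescopes. *)
Lemma tour_norm_cone (R : realType) n (w : nat -> 'cV[R]_2) j s t :
  symmetric_polygon n w -> 0 <= s -> 0 <= t ->
  tour_norm n w (s *: w j + t *: w j.+1) = s + t.
Proof.
move=> Pw s0 t0; set z := _ + _.
have fj : cross (edge_dual w j) z = s + t.
  rewrite /edge_dual crossZl; have := lt0r_neq0 (sym_step Pw j).
  by rewrite /z /cross !mxE => n0; field.
rewrite (tour_norm_window j z Pw).
have dec i : (j <= i < j + n)%N ->
    `|cross (edge_dual w i.+1 - edge_dual w i) z| =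
    - cross (edge_dual w i.+1) z - - cross (edge_dual w i) z.
  move=> /andP[ji ijn]; rewrite ler0_norm.
    by rewrite crossBl opprD.
  have [c c0 ->] := edge_dual_turn i Pw.
  rewrite crossZl mulr_ge0_le0// /z crossDr !crossZr.
  rewrite [cross _ (w j)]crossC [cross _ (w j.+1)]crossC !mulrN -opprD oppr_le0.
  rewrite addr_ge0// mulr_ge0// (sym_ahead Pw)//.
    by rewrite (leq_trans ji)//= .
  by rewrite ltnS ji addSn ltnW.
rewrite (eq_big_nat _ _ dec) telescope_sumr ?leq_addr//.
by rewrite edge_dual_anti// crossNl fj; field.
Qed.

(** The form [cross ^~ z] changes sign during half a turn, and [z] lies in the
    cone over the edge where it does so. *)
Lemma tour_cones_cover (R : realType) n (w : nat -> 'cV[R]_2) z :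
  symmetric_polygon n w ->
  exists i s t, [/\ 0 <= s, 0 <= t & z = s *: w i + t *: w i.+1].
Proof.
move=> Pw.
have [i [d0 d1]] : exists i, 0 <= cross (w i) z /\ cross (w i.+1) z <= 0.
  have [j dj] : exists j, 0 <= cross (w j) z.
    have [?|d0] := leP 0 (cross (w 0%N) z); first by exists 0%N.
    by exists (0 + n)%N; rewrite (sym_anti Pw) crossNl oppr_ge0 ltW.
  apply: contrapT => /forallNP no.
  have up m : 0 <= cross (w (j + m)%N) z.
    elim: m => [|m IH]; first by rewrite addn0.
    by rewrite addnS leNgt; apply/negP => /ltW h; exact: (no (j + m)%N).
  (* half a turn later the form is nonpositive too, which contradicts [no] just
     before that point *)
  apply: (no (j + n.-1)%N); split => //.
  have n0 : (0 < n)%N.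
    case: n Pw {no} => // Pw; have D := sym_step Pw 0%N.
    have := D; have := sym_anti Pw 0%N; rewrite addn0 => {1}->.
    by rewrite crossNl oppr_gt0 ltNge ltW.
  by rewrite -addnS prednK// (sym_anti Pw) crossNl oppr_le0.
have D := sym_step Pw i.
exists i, (- cross (w i.+1) z / cross (w i) (w i.+1)),
  (cross (w i) z / cross (w i) (w i.+1)); split.
- by rewrite divr_ge0 ?oppr_ge0// ltW.
- by rewrite divr_ge0// ltW.
apply: (scalerI (lt0r_neq0 D)); rewrite cross_cramer scalerDr !scalerA.
by rewrite ![cross (w i) (w i.+1) * _]mulrC !divfK// lt0r_neq0.
Qed.

Lemma tour_norm_is_norm (R : realType) n (w : nat -> 'cV[R]_2) :
  symmetric_polygon n w -> is_norm (tour_norm n w).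
Proof.
move=> Pw; split; [exact: tour_normD|exact: tour_normZ|move=> x].
have [i [s [t [s0 t0 ->]]]] := tour_cones_cover x Pw.
rewrite tour_norm_cone// => /eqP; rewrite paddr_eq0// => /andP[/eqP-> /eqP->].
by rewrite !scale0r addr0.
Qed.

Lemma tour_unit_ball (R : realType) n (w : nat -> 'cV[R]_2) :
  symmetric_polygon n w -> unit_ball (tour_norm n w) = tour_region w.
Proof.
move=> Pw; apply/seteqP; split=> x.
  rewrite /unit_ball/=; have [i [s [t [s0 t0 ->]]]] := tour_cones_cover x Pw.
  by rewrite tour_norm_cone// => st; exists i => //; exists s, t.
by move=> [i _ [s [t [s0 t0 st ->]]]]; rewrite /unit_ball/= tour_norm_cone.
Qed.

(** On the cone over an edge the norm is additive, so the bound at the two ends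
    of the edge extends to the cone by the triangle inequality. *)
Lemma tour_contraction (R : realType) n (w : nat -> 'cV[R]_2) (M : 'M[R]_2) :
  symmetric_polygon n w -> (forall i, tour_norm n w (M *m w i) <= 1) ->
  forall x, tour_norm n w (M *m x) <= tour_norm n w x.
Proof.
move=> Pw Mw x; have [i [s [t [s0 t0 ->]]]] := tour_cones_cover x Pw.
rewrite tour_norm_cone// mulmxDr -!scalemxAr.
apply: (le_trans (tour_normD _ _ _ _)); rewrite !tour_normZ !ger0_norm//.
by rewrite lerD// -[leRHS]mulr1 ler_wpM2l.
Qed.

Lemma shift_ind (n : nat) (P : nat -> Prop) :
  (0 < n)%N -> (forall i, (i < n)%N -> P i) -> (forall i, P i -> P (i + n)%N) ->
  forall i, P i.
Proof.
move=> n0 P0 PS; elim/ltn_ind => i IH; have [/P0//|ni] := ltnP i n.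
by rewrite -(subnK ni); apply/PS/IH; rewrite ltn_subrL n0 (leq_trans n0).
Qed.

(** By antisymmetry the conditions need to be checked on half a turn only; for
    [i < n <= j] the position of [w j] relative to [w i] is that of [w i] relative
    to [w (j - n)]. *)
Lemma symmetric_polygon_half (R : realType) n (w : nat -> 'cV[R]_2) :
  (0 < n)%N -> (forall i, w (i + n)%N = - w i) ->
  (forall i j, (i < j < n)%N -> 0 <= cross (w i) (w j)) ->
  (forall i, (i < n)%N -> 0 < cross (w i) (w i.+1)) ->
  (forall i, (i < n)%N -> cross (w i) (w i.+2) <=
                 cross (w i) (w i.+1) + cross (w i.+1) (w i.+2)) ->
  symmetric_polygon n w.
Proof.
move=> n0 anti ahead step turn.
have crossNN (x y : 'cV[R]_2) : cross (- x) (- y) = cross x y.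
  by rewrite crossNl crossNr opprK.
have ahead' i j : (i <= j < n)%N -> 0 <= cross (w i) (w j).
  rewrite leq_eqVlt => /andP[/predU1P[->|ij jn]]; first by rewrite crossxx.
  by rewrite ahead// ij.
split=> //; last 2 first.
- apply: (shift_ind n0) => // i; by rewrite -addSn !anti crossNN.
- apply: (shift_ind n0) => // i; by rewrite -!addSn !anti !crossNN.
suff H : forall i d, (d <= n)%N -> 0 <= cross (w i) (w (i + d)%N).
  by move=> i j /andP[ij jn]; rewrite -(subnKC ij) H// leq_subLR.
apply: (shift_ind n0) => [i lin d dn|i H d dn]; last first.
  by rewrite addnAC !anti crossNN H.
have [ind|nid] := ltnP (i + d) n; first by rewrite ahead'// leq_addr.
rewrite -(subnK nid) anti crossNr -crossC ahead'// lin andbT.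
by rewrite leq_subLR addnC leq_add2r.
Qed.

Lemma tour_norm_le1 (R : realType) n (w : nat -> 'cV[R]_2) i s t :
  symmetric_polygon n w -> 0 <= s -> 0 <= t -> s + t <= 1 ->
  tour_norm n w (s *: w i + t *: w i.+1) <= 1.
Proof. by move=> Pw s0 t0; rewrite tour_norm_cone. Qed.

Lemma tour_norm_vertex (R : realType) n (w : nat -> 'cV[R]_2) i :
  symmetric_polygon n w -> tour_norm n w (w i) = 1.
Proof.
move=> Pw; have := tour_norm_cone i Pw ler01 (lexx 0).
by rewrite scale1r scale0r !addr0.
Qed.

Lemma tour_norm_mul_half (R : realType) n (w : nat -> 'cV[R]_2) (M : 'M[R]_2) :
  (0 < n)%N -> symmetric_polygon n w ->
  (forall i, (i < n)%N -> tour_norm n w (M *m w i) <= 1) ->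
  forall i, tour_norm n w (M *m w i) <= 1.
Proof.
move=> n0 Pw Mw; apply: (shift_ind n0) => // i.
by rewrite (sym_anti Pw) mulmxN tour_normN.
Qed.

(** * The twelve vertices *)

Lemma scale_cv2 (R : realType) (a b c : R) :
  a *: cv2 b c = cv2 (a * b) (a * c).
Proof. by apply: eq_cV2; rewrite !mxE. Qed.

Lemma opp_cv2 (R : realType) (b c : R) : - cv2 b c = cv2 (- b) (- c).
Proof. by apply: eq_cV2; rewrite !mxE. Qed.

Lemma add_cv2 (R : realType) (a b c d : R) :
  cv2 a b + cv2 c d = cv2 (a + c) (b + d).
Proof. by apply: eq_cV2; rewrite !mxE. Qed.

Lemma mul_mx22_cv2 (R : realType) (a b c d x y : R) :
  mx22 a b c d *m cv2 x y = cv2 (a * x + b * y) (c * x + d * y).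
Proof. by apply: eq_cV2; rewrite !mxE !big_ord_recl big_ord0 !mxE addr0. Qed.

Lemma cross_cv2 (R : realType) (a b c d : R) :
  cross (cv2 a b) (cv2 c d) = b * c - a * d.
Proof. by rewrite /cross !mxE. Qed.

(** The extension of the vertex list to all indices that makes half a turn
    a change of sign. *)
Definition vertex_tour {R : realType} (k mu : R) (i : nat) : 'cV[R]_2 :=
  (-1) ^+ (i %/ 6) *: (half_vertices k mu)`_(i %% 6).

Lemma vertex_tour_anti (R : realType) (k mu : R) i :
  vertex_tour k mu (i + 6)%N = - vertex_tour k mu i.
Proof.
by rewrite /vertex_tour divnDr// modnDr divnn/= exprD expr1 mulrN1 scaleNr.
Qed.

Lemma vertex_tour_lt6 (R : realType) (k mu : R) i : (i < 6)%N ->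
  vertex_tour k mu i = (half_vertices k mu)`_i.
Proof. by move=> i6; rewrite /vertex_tour divn_small// modn_small// scale1r. Qed.

Lemma vertexE (R : realType) (k mu : R) (i : 'I_12) :
  vertex k mu i = vertex_tour k mu i.
Proof.
case: i => i i12; have sz : size (half_vertices k mu) = 6%N by [].
rewrite /vertex nth_cat sz -[nat_of_ord _]/i.
have [i6|i6] := ltnP i 6; first by rewrite vertex_tour_lt6.
have j6 : (i - 6 < 6)%N by rewrite ltn_subLR.
by rewrite (nth_map 0) ?sz// -[in RHS](subnK i6) vertex_tour_anti vertex_tour_lt6.
Qed.

Lemma vertex_tour_mod (R : realType) (k mu : R) i :
  vertex_tour k mu (i %% 12)%N = vertex_tour k mu i.
Proof.
elim/(@shift_ind 12): i => // i IH; first by rewrite modn_small.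
by rewrite modnDr IH -[12%N]/(6 + 6)%N addnA !vertex_tour_anti opprK.
Qed.

Lemma polygonSE (R : realType) (k mu : R) :
  polygonS k mu = tour_region (vertex_tour k mu).
Proof.
apply/seteqP; split=> x [i _].
  rewrite !vertexE /= vertex_tour_mod => xi; by exists (val i).
move=> xi; exists (inord (i %% 12)) => //.
have e : (inord (i %% 12) : 'I_12) = (i %% 12)%N :> nat.
  by rewrite inordK// ltn_mod.
have e1 : ((i %% 12).+1 %% 12 = i.+1 %% 12)%N.
  by rewrite -[in LHS](addn1 (i %% 12)) modnDml addn1.
by rewrite !vertexE /= e e1 !vertex_tour_mod.
Qed.

(** * Coordinates in terms of the cube root of the parameter *)

(** With [k = y ^+ 3] the scaling factor, hence every coordinate of a vertex, is
    a rational function of [y] and [mu]. *)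
Lemma cube_powR23 (R : realType) (y : R) :
  0 < y -> (y ^+ 3) `^ (2 / 3) = y ^+ 2.
Proof.
move=> y0; rewrite -!powR_mulrn ?ltW// -powRrM (_ : 3 * (2 / 3) = 2)//.
by field.
Qed.

Lemma cube_root_exists (R : realType) (k : R) :
  0 < k -> exists2 y, 0 < y & k = y ^+ 3.
Proof.
move=> k0; exists (k `^ (1 / 3)); first by rewrite powR_gt0.
rewrite -powR_mulrn ?powR_ge0// -powRrM (_ : 1 / 3 * 3 = 1) ?powRr1 ?ltW//.
by field.
Qed.

(** The hypotheses of the theorem on [k = y ^+ 3] and [mu = m], cleared of the
    denominator and of the power [k `^ (2 / 3) = y ^+ 2]. *)
Definition admissible {R : realType} (y m : R) : Prop :=
  [/\ 1 < y, y ^+ 2 <= m & m * (1 + y ^+ 6 + y ^+ 12) <= (1 + y ^+ 6) ^+ 2].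

Lemma Atilde_cv2 (R : realType) (y a b : R) : 0 < y ->
  Atilde (y ^+ 3) *m cv2 a b = cv2 (- b / y ^+ 5) (y * a - b / y ^+ 2).
Proof.
move=> y0; have yn0 := lt0r_neq0 y0.
rewrite /Atilde /Amx powRN cube_powR23// -scalemxAl mul_mx22_cv2 scale_cv2.
by congr cv2; field.
Qed.

Lemma Btilde_cv2 (R : realType) (y a b : R) : 0 < y ->
  Btilde (y ^+ 3) *m cv2 a b = cv2 (- y * b) (a / y ^+ 5 - b / y ^+ 2).
Proof.
move=> y0; have yn0 := lt0r_neq0 y0.
rewrite /Btilde /Bmx powRN cube_powR23// -scalemxAl mul_mx22_cv2 scale_cv2.
by congr cv2; field.
Qed.

Lemma half_verticesE (R : realType) (y m : R) :
  0 < y ->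
  let q := 1 + y ^+ 6 in
  half_vertices (y ^+ 3) m =
  [:: cv2 m (m * y ^+ 3 / q); cv2 1 0;
      cv2 (m / (y ^+ 2 * q)) (- (m * y ^+ 7 / q)); cv2 0 (- y);
      cv2 (- (m * y ^+ 2 / q)) (- (m / y)); cv2 (- y ^+ 2) (- y^-1)].
Proof.
move=> y0 q; rewrite /half_vertices.
have q0 : q != 0 by rewrite gt_eqF// addr_gt0 ?exprn_gt0.
have yn0 := lt0r_neq0 y0.
rewrite !(scale_cv2, Atilde_cv2, Btilde_cv2, opp_cv2)// -exprM -/q.
by do !congr (_ :: _); congr cv2; rewrite /q; field; rewrite -/q ?q0 ?yn0.
Qed.

(** For [m > 0] all fifteen values are positive, so the first six vertices follow
    each other clockwise within a half-plane; the turns at the vertices are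
    differences of these values. *)
Lemma vertex_cross (R : realType) (y m : R) :
  0 < y ->
  let q := 1 + y ^+ 6 in let p := 1 + y ^+ 6 + y ^+ 12 in
  let D i j := cross (vertex_tour (y ^+ 3) m i) (vertex_tour (y ^+ 3) m j) in
  [/\ [/\ D 0%N 1%N = m * y ^+ 3 / q, D 0%N 2%N = m ^+ 2 * y * p / q ^+ 2,
          D 0%N 3%N = m * y, D 0%N 4%N = m ^+ 2 * p / (y * q ^+ 2)
        & D 0%N 5%N = m / (y * q)],
      [/\ D 1%N 2%N = m * y ^+ 7 / q, D 1%N 3%N = y, D 1%N 4%N = m / y
        & D 1%N 5%N = y^-1],
      [/\ D 2%N 3%N = m / (y * q), D 2%N 4%N = m ^+ 2 * p / (y ^+ 3 * q ^+ 2)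
        & D 2%N 5%N = m * (1 + y ^+ 12) / (y ^+ 3 * q)]
    & [/\ D 3%N 4%N = m * y ^+ 3 / q, D 3%N 5%N = y ^+ 3 & D 4%N 5%N = m * y ^+ 7 / q]].
Proof.
move=> y0 q p D.
have q0 : q != 0 by rewrite gt_eqF// addr_gt0 ?exprn_gt0.
have yn0 := lt0r_neq0 y0.
rewrite /D !vertex_tour_lt6// !half_verticesE//= !cross_cv2 -/q.
by split; split; rewrite /p /q; field; rewrite -/q ?q0 ?yn0.
Qed.

(** * Convexity and invariance of the polygon *)

(** Each of the six turns is a positive factor times a difference whose sign is
    given by [q3], by [q4], or by the upper bound [m * p <= q ^+ 2] combined with
    [q1] or [q2]. *)
Lemma vertex_polygon (R : realType) (y m : R) :
  admissible y m -> symmetric_polygon 6 (vertex_tour (y ^+ 3) m).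
Proof.
move=> [y1 ym mp]; have y0 : 0 < y by apply: lt_trans y1.
have m0 : 0 < m by apply: lt_le_trans ym; rewrite exprn_gt0.
have := vertex_cross m y0; move: mp; set q := 1 + y ^+ 6.
set p := q + y ^+ 12 => mp /=; set w := vertex_tour _ _.
have q0 : 0 < q by rewrite addr_gt0 ?exprn_gt0.
have p0 : 0 < p by rewrite addr_gt0 ?exprn_gt0.
have c0 : 0 < 1 + y ^+ 12 by rewrite addr_gt0 ?exprn_gt0.
move=> [[D01 D02 D03 D04 D05] [D12 D13 D14 D15] [D23 D24 D25] [D34 D35 D45]].
have w6 : w 6%N = - w 0%N by rewrite -vertex_tour_anti.
have w7 : w 7%N = - w 1%N by rewrite -vertex_tour_anti.
have pos := (divr_gt0, mulr_gt0, exprn_gt0, invr_gt0).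
have [q1 q2 q3 q4] : [/\ q <= y ^+ 2 + y ^+ 6, q <= 1 + y ^+ 8,
    y ^+ 2 * q <= m * (1 + y ^+ 8) & q <= m * (1 + y ^+ 4)].
  have y2 : 1 <= y ^+ 2 by rewrite exprn_ege1// ltW.
  have y4 : 1 <= y ^+ 4 by rewrite exprn_ege1// ltW.
  have y68 : y ^+ 6 <= y ^+ 8 by rewrite ler_weXn2l// ltW.
  have le1 : q <= y ^+ 2 + y ^+ 6 by rewrite lerD2r.
  have le2 : q <= 1 + y ^+ 8 by rewrite lerD2l.
  split=> //; first by rewrite ler_pM// ltW// exprn_gt0.
  apply: (le_trans le1); rewrite (_ : y ^+ 2 + _ = y ^+ 2 * (1 + y ^+ 4)).
    by rewrite ler_wpM2r// addr_ge0 ?exprn_ge0// ltW.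
  by rewrite mulrDr mulr1 -exprD.
have mpq a : q <= a -> m * p <= q * a.
  by move=> qa; rewrite (le_trans mp)// expr2 ler_wpM2l// ltW.
have yn0 := lt0r_neq0 y0; have qn0 := lt0r_neq0 q0.
clearbody p q.
apply: symmetric_polygon_half => //.
- exact: vertex_tour_anti.
- move=> i j /andP[ij j6]; apply: ltW.
  move: i j ij j6 => [|[|[|[|[|i]]]]] [|[|[|[|[|[|j]]]]]] // _ _;
    by rewrite ?D01 ?D02 ?D03 ?D04 ?D05 ?D12 ?D13 ?D14 ?D15 ?D23 ?D24 ?D25 ?D34
    ?D35 ?D45 ?pos.
- move=> [|[|[|[|[|[|i]]]]]] // _; rewrite ?w6 ?crossNr -?crossC;
    by rewrite ?D01 ?D12 ?D23 ?D34 ?D45 ?D05 !pos.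
move=> [|[|[|[|[|[|i]]]]]] // _; rewrite ?w6 ?w7 ?crossNr ?crossNl -?crossC;
  rewrite ?opprK ?D01 ?D12 ?D23 ?D34 ?D45 ?D05 ?D02 ?D13 ?D24 ?D35 ?D04 ?D15
  -subr_ge0.
- rewrite (_ : _ - _ = m * y / q ^+ 2 * (q * (y ^+ 2 + y ^+ 6) - m * p)).
    by rewrite mulr_ge0 ?subr_ge0 ?mpq// ltW// !pos.
  by field.
- rewrite (_ : _ - _ = (m * (1 + y ^+ 8) - y ^+ 2 * q) / (y * q)).
    by rewrite divr_ge0 ?subr_ge0// ltW// !pos.
  by field; rewrite qn0 yn0.
- rewrite (_ : _ - _ = m / (y ^+ 3 * q ^+ 2) * (q * (y ^+ 2 + y ^+ 6) - m * p)).
    by rewrite mulr_ge0 ?subr_ge0 ?mpq// ltW// !pos.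
  by field; rewrite qn0 yn0.
- rewrite (_ : _ - _ = y ^+ 3 / q * (m * (1 + y ^+ 4) - q)).
    by rewrite mulr_ge0 ?subr_ge0// ltW// !pos.
  by field.
- rewrite (_ : _ - _ = m / (y * q ^+ 2) * (q * (1 + y ^+ 8) - m * p)).
    by rewrite mulr_ge0 ?subr_ge0 ?mpq// ltW// !pos.
  by field; rewrite qn0 yn0.
rewrite (_ : _ - _ = (m * (1 + y ^+ 4) - q) / (y * q)).
  by rewrite divr_ge0 ?subr_ge0// ltW// !pos.
by field; rewrite qn0 yn0.
Qed.

(** The images of [v_4] and [v_6] are not multiples of vertices; they are written
    in the basis formed by the ends of an edge, and they are in the polygon when
    the two coordinates, which are nonnegative, sum to at most 1.  For [v_6] this
    is the lower bound on [m]. *)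
Lemma Atilde_vertex (R : realType) (y m : R) :
  admissible y m ->
  let w := vertex_tour (y ^+ 3) m in
  forall i, tour_norm 6 w (Atilde (y ^+ 3) *m w i) <= 1.
Proof.
move=> adm w; have Pw : symmetric_polygon 6 w by exact: vertex_polygon.
move: adm => [y1 ym mp].
have y0 : 0 < y by apply: lt_trans y1.
have m0 : 0 < m by apply: lt_le_trans ym; rewrite exprn_gt0.
have y12 : 1 <= y ^+ 12 by rewrite exprn_ege1// ltW.
have yi : 0 <= y ^- 12 by rewrite invr_ge0 exprn_ge0// ltW.
have m1 : 1 <= m by apply: le_trans ym; rewrite exprn_ege1// ltW.
have [yn0 mn0] := (lt0r_neq0 y0, lt0r_neq0 m0).
have qn0 : 1 + y ^+ 6 != 0 by rewrite gt_eqF// addr_gt0 ?exprn_gt0.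
have W i : (i < 6)%N -> w i = (half_vertices (y ^+ 3) m)`_i.
  exact: vertex_tour_lt6.
have w6 i : w (i + 6)%N = - w i := vertex_tour_anti _ _ i.
apply: tour_norm_mul_half => //.
move=> [|[|[|[|[|[|i]]]]]] // _.
- rewrite (_ : Atilde _ *m _ = w (2 + 6)%N) ?tour_norm_vertex//.
  by rewrite w6 !W//= opprK.
- rewrite (_ : Atilde _ *m _ = w (3 + 6)%N) ?tour_norm_vertex//.
  by rewrite w6 !W//= opprK.
- rewrite (_ : Atilde _ *m _ = w (4 + 6)%N) ?tour_norm_vertex//.
  by rewrite w6 !W//= opprK.
(* Atilde v_4, over the edge from v_11 to v_12 *)
- rewrite (_ : _ *m _ =
      (y ^+ 12 - 1) / (m * y ^+ 12) *: w (4 + 6)%N + y ^- 12 *: w (5 + 6)%N).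
    apply: tour_norm_le1 => //.
      by rewrite divr_ge0 ?subr_ge0// mulr_ge0 ?exprn_ge0// ltW.
    rewrite -subr_ge0 (_ : _ - _ = (y ^+ 12 - 1) * (m - 1) / (m * y ^+ 12)).
      rewrite divr_ge0 ?mulr_ge0 ?subr_ge0 ?exprn_ge0// ltW//.
    by field; rewrite mn0 yn0.
  rewrite !w6 !W// half_verticesE//= Atilde_cv2//.
  rewrite ?(scale_cv2, opp_cv2, add_cv2).
  by congr cv2; field; rewrite ?mn0 ?yn0 ?qn0.
- rewrite (_ : _ *m _ = y ^- 6 *: w 0%N).
    rewrite tour_normZ tour_norm_vertex// mulr1 ger0_norm; last first.
      by rewrite invr_ge0 exprn_ge0// ltW.
    by rewrite invf_le1 ?exprn_gt0// exprn_ege1// ltW.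
  rewrite !W// half_verticesE//= Atilde_cv2//.
  rewrite ?(scale_cv2, opp_cv2, add_cv2).
  by congr cv2; field; rewrite ?mn0 ?yn0 ?qn0.
(* Atilde v_6, over the edge from v_2 to v_3 *)
rewrite (_ : _ *m _ =
    y ^- 12 *: w 1%N + y ^+ 2 * (y ^+ 12 - 1) / (m * y ^+ 12) *: w 2%N).
  apply: tour_norm_le1 => //.
    by rewrite divr_ge0 ?mulr_ge0 ?subr_ge0 ?exprn_ge0// ltW.
  rewrite -subr_ge0 (_ : _ - _ = (y ^+ 12 - 1) * (m - y ^+ 2) / (m * y ^+ 12)).
    by rewrite divr_ge0 ?mulr_ge0 ?subr_ge0 ?exprn_ge0// ltW.
  by field; rewrite mn0 yn0.
rewrite !W// half_verticesE//= Atilde_cv2//.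
rewrite ?(scale_cv2, opp_cv2, add_cv2).
by congr cv2; field; rewrite ?mn0 ?yn0 ?qn0.
Qed.

(** As for [Atilde_vertex], with [v_1] and [v_3] in the place of [v_4] and [v_6]:
    for [v_3] the sum of the coordinates is at most 1 exactly when the upper bound
    on [m] holds, and for [v_1] a weaker upper bound suffices. *)
Lemma Btilde_vertex (R : realType) (y m : R) :
  admissible y m ->
  let w := vertex_tour (y ^+ 3) m in
  forall i, tour_norm 6 w (Btilde (y ^+ 3) *m w i) <= 1.
Proof.
move=> adm w; have Pw : symmetric_polygon 6 w by exact: vertex_polygon.
move: adm => [y1 ym mp].
have y0 : 0 < y by apply: lt_trans y1.
have m0 : 0 < m by apply: lt_le_trans ym; rewrite exprn_gt0.
have ge1 n : 1 <= y ^+ n by rewrite exprn_ege1// ltW.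
have ge0 n : 0 <= y ^+ n by rewrite exprn_ge0// ltW.
have q0 : 0 < 1 + y ^+ 6 by rewrite addr_gt0 ?exprn_gt0.
have [yn0 mn0] := (lt0r_neq0 y0, lt0r_neq0 m0); have qn0 := lt0r_neq0 q0.
have W i : (i < 6)%N -> w i = (half_vertices (y ^+ 3) m)`_i.
  exact: vertex_tour_lt6.
have w6 i : w (i + 6)%N = - w i := vertex_tour_anti _ _ i.
apply: tour_norm_mul_half => //.
move=> [|[|[|[|[|[|i]]]]]] // _.
(* Btilde v_1, over the edge from v_8 to v_9 *)
- rewrite (_ : _ *m _ =
      m * (y ^+ 18 - 1) / (y ^+ 14 * (1 + y ^+ 6)) *: w (1 + 6)%N +
      y ^- 12 *: w (2 + 6)%N).
    apply: tour_norm_le1; rewrite ?invr_ge0//.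
      by rewrite divr_ge0 ?mulr_ge0 ?subr_ge0// ltW.
    rewrite -subr_ge0 (_ : _ - _ = (y ^+ 6 - 1) *
      (y ^+ 2 * (1 + y ^+ 6) ^+ 2 - m * (1 + y ^+ 6 + y ^+ 12))
      / (y ^+ 14 * (1 + y ^+ 6))).
      apply: divr_ge0; last by rewrite mulr_ge0// ltW.
      rewrite mulr_ge0 ?subr_ge0// (le_trans mp)// ler_peMl// exprn_ge0//.
      exact: ltW.
    by field; rewrite qn0 yn0.
  rewrite !w6 !W// half_verticesE//= Btilde_cv2//.
  rewrite ?(scale_cv2, opp_cv2, add_cv2).
  by congr cv2; field; rewrite ?mn0 ?yn0 ?qn0.
- rewrite (_ : _ *m _ = y ^- 6 *: w (3 + 6)%N).
    rewrite tour_normZ tour_norm_vertex// mulr1 ger0_norm ?invr_ge0//.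
    by rewrite invf_le1 ?exprn_gt0.
  rewrite !w6 !W// half_verticesE//= Btilde_cv2//.
  rewrite ?(scale_cv2, opp_cv2, add_cv2).
  by congr cv2; field; rewrite ?mn0 ?yn0 ?qn0.
(* Btilde v_3, over the edge from v_11 to v_12 *)
- rewrite (_ : _ *m _ = y ^- 12 *: w (4 + 6)%N +
      m * (y ^+ 18 - 1) / (y ^+ 12 * (1 + y ^+ 6)) *: w (5 + 6)%N).
    apply: tour_norm_le1; rewrite ?invr_ge0//.
      by rewrite divr_ge0 ?mulr_ge0 ?subr_ge0// ltW.
    rewrite -subr_ge0 (_ : _ - _ = (y ^+ 6 - 1) *
      ((1 + y ^+ 6) ^+ 2 - m * (1 + y ^+ 6 + y ^+ 12))
      / (y ^+ 12 * (1 + y ^+ 6))).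
      apply: divr_ge0; last by rewrite mulr_ge0// ltW.
      by rewrite mulr_ge0 ?subr_ge0.
    by field; rewrite qn0 yn0.
  rewrite !w6 !W// half_verticesE//= Btilde_cv2//.
  rewrite ?(scale_cv2, opp_cv2, add_cv2).
  by congr cv2; field; rewrite ?mn0 ?yn0 ?qn0.
- rewrite (_ : Btilde _ *m _ = w (5 + 6)%N) ?tour_norm_vertex//.
  by rewrite w6 !W//= opprK.
- rewrite (_ : Btilde _ *m _ = w 0%N) ?tour_norm_vertex//.
  rewrite !W// half_verticesE//= Btilde_cv2//.
  rewrite ?(scale_cv2, opp_cv2, add_cv2).
  by congr cv2; field; rewrite ?mn0 ?yn0 ?qn0.
rewrite (_ : Btilde _ *m _ = w 1%N) ?tour_norm_vertex//.
rewrite !W// half_verticesE//= Btilde_cv2//.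
rewrite ?(scale_cv2, opp_cv2, add_cv2).
by congr cv2; field; rewrite ?mn0 ?yn0 ?qn0.
Qed.

Theorem theorem3p7 (R : realType) (k mu : R)
  (hk1 : 1 < k) (hk2 : k <= kappa_max R)
  (hmu1 : k `^ (2 / 3) <= mu)
  (hmu2 : mu <= (k ^+ 2 + 1) ^+ 2 / (k ^+ 4 + k ^+ 2 + 1)) :
  (forall i : 'I_12,
     polygonS k mu (Atilde k *m vertex k mu i) /\
     polygonS k mu (Btilde k *m vertex k mu i)) /\
  (exists N : 'cV[R]_2 -> R,
     [/\ is_norm N,
         unit_ball N = polygonS k mu,
         forall x, N (Atilde k *m x) <= N x &
         forall x, N (Btilde k *m x) <= N x]).
Proof.
have [y y0 ky] := cube_root_exists (lt_trans ltr01 hk1); subst k.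
have adm : admissible y mu.
  split; last 1 first.
  - move: hmu2; rewrite ler_pdivlMr ?addr_gt0 ?exprn_gt0// => h.
    have -> : 1 + y ^+ 6 + y ^+ 12 = (y ^+ 3) ^+ 4 + (y ^+ 3) ^+ 2 + 1 by ring.
    by have -> : 1 + y ^+ 6 = (y ^+ 3) ^+ 2 + 1 by ring.
  - rewrite ltNge; apply/negP => /(exprn_ile1 3 (ltW y0)).
    by rewrite leNgt hk1.
  - by rewrite -cube_powR23.
have Pw := vertex_polygon adm.
have Aw := Atilde_vertex adm.
have Bw := Btilde_vertex adm.
rewrite polygonSE -(tour_unit_ball Pw); split.
  by move=> i; rewrite vertexE; split; [exact: Aw|exact: Bw].
exists (tour_norm 6 (vertex_tour (y ^+ 3) mu)); split => //.
- exact: tour_norm_is_norm Pw.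
- exact: tour_contraction Pw Aw.
- exact: tour_contraction Pw Bw.
Qed.
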